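(* For every integer $k\ge 1$, there are at most $k^2-k+1$ flat equiangular lines in $\mathbb{C}^k$.
   Context: A set of equiangular lines in $\mathbb{C}^k$ is a set of unit vectors, spanning pairwise distinct one-dimensional subspaces, such that $|x^*y|^2$ is the same constant for all pairs of distinct vectors $x,y$ in the set. The lines are flat if, in each of these vectors, all entries have the same absolute value (namely $1/\sqrt{k}$). *)

(* Defs.v *)
From HB Require Import structures.
From mathcomp Require Import all_boot all_order all_algebra.
From mathcomp Require Import sesquilinear spectral.
From mathcomp Require Import complex.
From mathcomp Require Import boolp classical_sets functions cardinality reals.

Set Implicit Arguments.
Unset Strict Implicit.
Unset Printing Implicit Defensive.

Import Order.TTheory GRing.Theory Num.Theory.

Local Open Scope ring_scope.
Local Open Scope classical_set_scope.
Local Open Scope sesquilinear_scope.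

Section FlatEquiangular.
Variables (C : numClosedFieldType) (k : nat).
Implicit Types (x y : 'cV[C]_k) (X : set 'cV[C]_k).

(* The scalar x^* y, conjugate-linear in x. *)
Definition hdot x y : C := (x ^t* *m y) 0 0.

(* X is an arbitrary, a priori possibly infinite, set of vectors, one for each
   line. *)
Definition equiangular_lines X : Prop :=
  [/\ forall x, X x -> hdot x x = 1,
      forall x y, X x -> X y -> x <> y -> <[x]>%VS <> <[y]>%VS
    & exists a : C,
        forall x y, X x -> X y -> x <> y -> `|hdot x y| ^+ 2 = a].

Definition flat x : Prop := forall i j : 'I_k, `|x i 0| = `|x j 0|.

Definition flat_equiangular_lines X : Prop :=
  equiangular_lines X /\ forall x, X x -> flat x.

End FlatEquiangular.

(* Main.v *)
(* The rank-one projections x x^* of equiangular lines have Gram matrix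
   (1 - a) I + a J with 0 <= a < 1, which is nonsingular, so they are linearly
   independent in the k^2-dimensional space of matrices.  Flatness makes the
   diagonal of each x x^* constant, which imposes k - 1 further independent
   linear conditions. *)
Require Import Defs.
From HB Require Import structures.
From mathcomp Require Import all_boot all_order all_algebra.
From mathcomp Require Import sesquilinear spectral.
From mathcomp Require Import complex ring zify.
From mathcomp Require Import boolp classical_sets functions cardinality reals.

Set Implicit Arguments.
Unset Strict Implicit.
Unset Printing Implicit Defensive.

Import Order.TTheory GRing.Theory Num.Theory.

Local Open Scope classical_set_scope.
Local Open Scope card_scope.

(** A finite [X] has more than [m] elements here, and an infinite one contains a copy of the
    naturals. This reduces the bound on an arbitrary set to a bound on injective finite families. *)
Lemma not_card_le_II (T : Type) (X : set T) (m : nat) :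
  ~ (X #<= `I_m) ->
  exists2 v : 'I_m.+1 -> T, injective v & forall i, X (v i).
Proof.
move=> Xm; have /card_leP[f] : `I_m.+1 #<= X.
  case: (pselect (finite_set X)) => [/finite_setP[n Xn]|/infiniteP Xinf].
    rewrite (card_le_eqr Xn) card_le_II ltnNge; apply/negP => nm.
    by apply: Xm; rewrite (card_le_eql Xn) card_le_II.
  exact: card_le_trans (card_leT _) Xinf.
have mem_ord (i : 'I_m.+1) : (i : nat) \in `I_m.+1 by apply/mem_set/ltn_ord.
exists (fun i => val (f (SigSub (mem_ord i)))) => [i j|i]; last first.
  exact/set_mem/valP.
move=> /val_inj fij; apply: val_inj.
by have /(congr1 val) := inj (in_setT _) (in_setT _) fij.
Qed.

Local Open Scope ring_scope.
Local Open Scope sesquilinear_scope.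

(** If [u *m G = 0], then [(1 - a) * u 0 j = - (a * S)] for every [j], where [S] is the sum of the
    entries of [u]. Summing over [j] gives [(1 - a + n * a) * S = 0] with a positive factor, so
    [S = 0] and then [u = 0]. *)
Lemma row_free_equal_entries (F : numFieldType) (n : nat) (a : F)
    (G : 'M[F]_n) :
    (forall i j, G i j = if i == j then 1 else a) -> 0 <= a -> a < 1 ->
  row_free G.
Proof.
move=> GE a_ge0 a_lt1; apply: inj_row_free => u uG0.
pose S := \sum_i u 0 i.
have uS j : (1 - a) * u 0 j = - (a * S).
  apply/eqP; rewrite -addr_eq0; apply/eqP.
  have := congr1 (fun w : 'rV_n => w 0 j) uG0; rewrite !mxE => <-.
  rewrite /S (bigD1 j) //= [RHS](bigD1 j) //= GE eqxx mulr1.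
  rewrite mulrDr addrA -mulrDl subrK mul1r; congr (_ + _).
  rewrite mulr_sumr; apply: eq_bigr => i ij.
  by rewrite GE (negPf ij) mulrC.
have b_gt0 : 0 < 1 - a by rewrite subr_gt0.
have S0 : S = 0.
  have : (1 - a) * S + n%:R * (a * S) = 0.
    rewrite {1}/S mulr_sumr (eq_bigr _ (fun j _ => uS j)).
    by rewrite sumr_const card_ord mulr_natl mulNrn addNr.
  have na_ge0 : 0 <= n%:R * a by rewrite mulr_ge0.
  rewrite [_ * (a * S)]mulrA -mulrDl => /eqP; rewrite mulf_eq0.
  by rewrite (gt_eqF (ltr_wpDr na_ge0 b_gt0)) => /eqP.
apply/rowP => j; apply/eqP; rewrite mxE.
move/eqP: (uS j); rewrite S0 mulr0 oppr0 mulf_eq0.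
by rewrite (gt_eqF b_gt0).
Qed.

Section ConstantDiagonal.
Variables (F : fieldType) (k : nat).

(** The kernel consists of the vectorised matrices with constant diagonal. *)
Definition diag_dev (w : 'rV[F]_(k.+1 * k.+1)) : 'rV[F]_k :=
  \row_j (vec_mx w (lift 0 j) (lift 0 j) - vec_mx w 0 0).

Fact diag_dev_is_linear : linear diag_dev.
Proof.
move=> c u w; apply/rowP => j; rewrite !mxE /= mulrBr.
by rewrite opprD addrACA.
Qed.
HB.instance Definition _ :=
  GRing.isLinear.Build F _ _ _ diag_dev diag_dev_is_linear.

Lemma rank_const_diag (n : nat) (A : 'M[F]_(n, k.+1 * k.+1)) :
    (forall i l, vec_mx (row i A) l l = vec_mx (row i A) 0 0) ->
  (\rank A <= k.+1 ^ 2 - k.+1 + 1)%N.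
Proof.
move=> Adiag; pose B := lin1_mx diag_dev.
have AB0 : A *m B = 0.
  apply/row_matrixP => i; rewrite row_mul mul_rV_lin1 row0.
  by apply/rowP => j; rewrite mxE Adiag subrr mxE.
have /eqP rankB : row_full B.
  apply/row_fullP.
  (* A right inverse: the diagonal matrix units other than the one at index 0 are sent to the
     standard basis. *)
  exists (\matrix_i mxvec (delta_mx (lift 0 i) (lift 0 i))).
  apply/row_matrixP => i; rewrite row_mul rowK mul_rV_lin1 row1 /=.
  apply/rowP => j; rewrite /diag_dev mxvecK !mxE /= subr0 andbb.
  by rewrite (inj_eq lift_inj).
(* The ranks of [A] and [B] add up to at most [k.+1 * k.+1], and [B] has rank [k]. *)
have := mulmx0_rank_max AB0.
rewrite rankB -mulnn; nia.
Qed.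

End ConstantDiagonal.

Section Lines.
Variable C : numClosedFieldType.

Lemma hdotE k (x y : 'cV[C]_k) : hdot x y = \sum_i (x i 0)^* * y i 0.
Proof. by rewrite /hdot mxE; apply: eq_bigr => i _; rewrite !mxE. Qed.

Lemma hdot_conj k (x y : 'cV[C]_k) : (hdot x y)^* = hdot y x.
Proof.
rewrite !hdotE rmorph_sum; apply: eq_bigr => i _.
by rewrite rmorphM /= conjCK mulrC.
Qed.

(* Pythagoras for y - <x,y> x: the equality case of Cauchy-Schwarz. *)
Lemma hdot_norm_lt1 k (x y : 'cV[C]_k) :
    hdot x x = 1 -> hdot y y = 1 -> <[x]>%VS <> <[y]>%VS ->
  `|hdot x y| ^+ 2 < 1.
Proof.
move=> x1 y1 xy; pose c := hdot x y; pose z := y - c *: x.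
have zz : \sum_i `|z i 0| ^+ 2 = 1 - `|c| ^+ 2.
  transitivity (hdot z z).
    by rewrite hdotE; apply: eq_bigr => i _; rewrite normCKC.
  transitivity (hdot y y - c * hdot y x - c^* * hdot x y + c^* * c * hdot x x).
    rewrite !hdotE !mulr_sumr -!sumrB -big_split /=.
    apply: eq_bigr => i _; rewrite !mxE rmorphB rmorphM /=.
    by ring.
  rewrite x1 y1 -/c -(hdot_conj x y) -/c mulr1 -normCK -normCKC.
  by rewrite subrK.
rewrite -subr_gt0 -zz lt_neqAle sumr_ge0 ?andbT; last first.
  by move=> i _; rewrite exprn_ge0.
apply: contra_notN xy; rewrite eq_sym => /eqP z0.
have z_eq0 : z = 0.
  apply/colP => i; apply/eqP; rewrite [X in _ == X]mxE -normr_eq0 -sqrf_eq0.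
  by apply/eqP; apply: (psumr_eq0P _ z0) => // j _; rewrite exprn_ge0.
have yE : y = c *: x by apply/eqP; rewrite -subr_eq0 -/z z_eq0.
(* If [c = 0], the norm identity [zz] would read 0 = 1. *)
have c_neq0 : c != 0.
  apply/eqP => c0; move: zz; rewrite z0 c0 normr0 expr0n subr0.
  by move/esym/eqP; rewrite oner_eq0.
apply/subv_anti/andP; split; rewrite -memvE; apply/vlineP.
  by exists c^-1; rewrite yE scalerA mulVf // scale1r.
by exists c.
Qed.

Lemma card_flat_equiangular k n (X : set 'cV[C]_k.+1) (v : 'I_n -> 'cV_k.+1) :
    flat_equiangular_lines X -> injective v -> (forall i, X (v i)) ->
  (n <= k.+1 ^ 2 - k.+1 + 1)%N.
Proof.
case=> [[X1 XL [a Xa]] Xflat] v_inj Xv.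
(* With fewer than two vectors no pair constrains [a], so its bounds below would not be
   available. *)
case: (leqP n 1) => [n_le1|n_gt1]; first by rewrite addn1 (leq_trans n_le1).
have va i j : i != j -> `|hdot (v i) (v j)| ^+ 2 = a.
  by move/eqP=> ij; apply: Xa => // /v_inj.
pose i0 := Ordinal (ltnW n_gt1); pose i1 := Ordinal n_gt1.
have a_ge0 : 0 <= a by rewrite -(va i0 i1) // exprn_ge0.
have a_lt1 : a < 1.
  by rewrite -(va i0 i1) //; apply: hdot_norm_lt1; auto; apply: XL => // /v_inj.
pose A := \matrix_i mxvec (v i *m (v i)^t*).
(* Row [i] is the transposed projection, vectorised, so its product with row [j] of [A] is the trace
   form of the two projections, namely [|hdot (v i) (v j)|^2]. *)
pose B := \matrix_i mxvec (((v i)^t*)^T *m (v i)^T).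
have : row_free (B *m A^T).
  apply: row_free_equal_entries a_ge0 a_lt1 => i j.
  have -> : (B *m A^T) i j = (row i B *m (row j A)^T) 0 0.
    by rewrite !mxE; apply: eq_bigr => l _; rewrite !mxE.
  rewrite !rowK mxvec_dotmul trmxK mulmxA -mulmxA.
  rewrite mxE big_ord1 -!/(hdot _ _) -[hdot (v j) _]hdot_conj -normCK.
  by have [->|/va//] := eqVneq; rewrite X1 // normr1 expr1n.
(* The product has rank [n], which cannot exceed the rank of [A]. *)
rewrite /row_free => /eqP <-.
apply: (leq_trans (mxrankM_maxr _ _)); rewrite mxrank_tr.
apply: rank_const_diag => i l; rewrite rowK mxvecK !mxE !big_ord1 !mxE.
(* The diagonal entries of a projection are the squared moduli of the entries of [v i]. *)
by rewrite -!normCK (Xflat _ (Xv i) l 0).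
Qed.

End Lines.

Theorem lemma6p2p1 (R : realType) (k : nat) (hk : (1 <= k)%N)
    (X : set 'cV[R[i]]_k) (hX : flat_equiangular_lines X) :
  X #<= `I_(k ^ 2 - k + 1)%N.
Proof.
(* For positive dimension, if the bound failed, [X] would contain one more distinct vector than a
   finite family can have. *)
case: k hk X hX => // k _ X hX; apply: contrapT => /not_card_le_II[v v_inj Xv].
by have := card_flat_equiangular hX v_inj Xv; rewrite ltnn.
Qed.
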